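(* Let $\mathcal{H}>0$ be a constant such that $\|e^{-t\Delta^2}\varphi\|_{L^q}\leq\mathcal{H}t^{-\frac N4(\frac1p-\frac1q)}\|\varphi\|_{L^p}$ for all $1\leq p\leq q\leq\infty$, $t>0$, $\varphi\in L^p(\mathbb{R}^N)$ (such a constant exists). Let $1\leq p\leq2$ and $1\leq q\leq\infty$. Then: (i) $\|e^{-t\Delta^2}\varphi\|_{\exp L^2}\leq\mathcal{H}\|\varphi\|_{\exp L^2}$ for all $t>0$ and $\varphi\in\exp L^2(\mathbb{R}^N)$; (ii) $\|e^{-t\Delta^2}\varphi\|_{\exp L^2}\leq\mathcal{H}\,t^{-\frac{N}{4p}}\big(\log(t^{-\frac N4}+1)\big)^{-1/2}\|\varphi\|_{L^p}$ for all $t>0$ and $\varphi\in L^p(\mathbb{R}^N)$; (iii) $\|e^{-t\Delta^2}\varphi\|_{\exp L^2}\leq\frac{\mathcal{H}}{\sqrt{\log2}}\big[t^{-\frac{N}{4q}}\|\varphi\|_{L^q}+\|\varphi\|_{L^2}\big]$ for all $t>0$ and $\varphi\in L^q\cap L^2(\mathbb{R}^N)$.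
   Context: $e^{-t\Delta^2}$ denotes the biharmonic heat semigroup on $\mathbb{R}^N$: $e^{-t\Delta^2}\varphi=E_t\star\varphi$ with $E_t(x)=(2\pi)^{-N}\int_{\mathbb{R}^N}e^{-t|\xi|^4}e^{ix\cdot\xi}\,d\xi$. The Orlicz space $\exp L^2(\mathbb{R}^N)$ is the set of $u\in L^1_{loc}(\mathbb{R}^N)$ such that $\int_{\mathbb{R}^N}(e^{|u(x)|^2/\alpha^2}-1)\,dx<\infty$ for some $\alpha>0$, with the Luxemburg norm $\|u\|_{\exp L^2}=\inf\{\alpha>0:\int_{\mathbb{R}^N}(e^{|u(x)|^2/\alpha^2}-1)\,dx\leq 1\}$. *)

(* Defs.v *)
From HB Require Import structures.
From mathcomp Require Import all_boot all_order all_algebra.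
From mathcomp Require Import all_classical all_reals all_analysis.
From mathcomp Require Import complex.

Set Implicit Arguments.
Unset Strict Implicit.
Unset Printing Implicit Defensive.
Import Order.TTheory GRing.Theory Num.Theory.

Local Open Scope classical_set_scope.
Local Open Scope ring_scope.
Local Open Scope complex_scope.

Section prodm.
Local Open Scope ereal_scope.
Context d1 d2 (T1 : measurableType d1) (T2 : measurableType d2) (R : realType).
Variable m1 : {sigma_finite_measure set T1 -> \bar R}.
Variable m2 : {sigma_finite_measure set T2 -> \bar R}.
Definition prodm : set (T1 * T2) -> \bar R := (m1 \x m2).
HB.instance Definition _ := Measure.on prodm.
Lemma prodm_sigma_finite : sigma_finite setT prodm.
Proof.
have /sigma_finiteP[F [TF ndF Foo]] := sigma_finiteT m1.
have /sigma_finiteP[G [TG ndG Goo]] := sigma_finiteT m2.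
exists (fun n => F n `*` G n).
 rewrite -setXTT TF TG predeqE => -[x y]; split.
    move=> [/= [n _ Fnx] [k _ Gky]]; exists (maxn n k) => //; split.
    - by move: x Fnx; exact/subsetPset/ndF/leq_maxl.
    - by move: y Gky; exact/subsetPset/ndG/leq_maxr.
  by move=> [n _ []/= ? ?]; split; exists n.
move=> k; have [? ?] := Foo k; have [? ?] := Goo k.
split; first exact: measurableX.
by rewrite /prodm product_measure1E// lte_mul_pinfty// ge0_fin_numE.
Qed.
HB.instance Definition _ := Measure_isSigmaFinite.Build _ _ _ prodm
  prodm_sigma_finite.
End prodm.

(* R^(n+1) is modelled as the iterated product R * (R * ( ... * R)) with the  *)
(* product sigma-algebra and the (iterated) product of Lebesgue measures,     *)
(* i.e. N-dimensional Lebesgue measure on the Borel sets of R^N.              *)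
Record euclid (R : realType) := Euclid {
  e_disp : measure_display;
  e_type : measurableType e_disp;
  e_meas : {sigma_finite_measure set e_type -> \bar R};
  e_add : e_type -> e_type -> e_type;
  e_opp : e_type -> e_type;
  e_dot : e_type -> e_type -> R
}.

(* Rsucc_space R n is R^(n+1) *)
Fixpoint Rsucc_space (R : realType) (n : nat) : euclid R :=
  match n with
  | 0 => @Euclid R _ (measurableTypeR R)
      (@lebesgue_measure R : {sigma_finite_measure set measurableTypeR R -> \bar R}) +%R -%R *%R
  | n'.+1 =>
      let E := Rsucc_space R n' in
      @Euclid R _ (measurableTypeR R * e_type E)%type
        (@prodm _ _ (measurableTypeR R) (e_type E) R (@lebesgue_measure R) (e_meas E)
          : {sigma_finite_measure set (measurableTypeR R * e_type E)%type -> \bar R})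
        (fun x y => (x.1 + y.1, e_add x.2 y.2))
        (fun x => (- x.1, e_opp x.2))
        (fun x y => x.1 * y.1 + e_dot x.2 y.2)
  end.

(* R^N, for N >= 1 *)
Definition RN (R : realType) (N : nat) : euclid R := Rsucc_space R N.-1.
Definition pt (R : realType) (N : nat) := e_type (RN R N).
Definition lebN (R : realType) (N : nat) := e_meas (RN R N).

Definition sqnorm (R : realType) (N : nat) (x : pt R N) : R := e_dot x x.

Definition Cint (R : realType) (N : nat) (f : pt R N -> R[i]) : R[i] :=
  (Rintegral (lebN R N) setT (fun x => complex.Re (f x)))%:C
  + 'i * (Rintegral (lebN R N) setT (fun x => complex.Im (f x)))%:C.

Definition expi (R : realType) (s : R) : R[i] := (cos s +i* sin s)%C.

Definition biharm_kernel (R : realType) (N : nat) (t : R) (x : pt R N) : R[i] :=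
  ((2 * pi) ^- N)%:C *
  Cint (fun xi : pt R N => (expR (- t * (sqnorm xi) ^+ 2))%:C * expi (e_dot x xi)).

Definition biharm_sg (R : realType) (N : nat) (t : R) (phi : pt R N -> R)
  (x : pt R N) : R[i] :=
  Cint (fun y : pt R N => biharm_kernel t (e_add x (e_opp y)) * (phi y)%:C).

Definition cmod (R : realType) (z : R[i]) : R :=
  Num.sqrt (complex.Re z ^+ 2 + complex.Im z ^+ 2).

Definition LpnormC (R : realType) (N : nat) (p : \bar R) (f : pt R N -> R[i])
  : \bar R := Lnorm (lebN R N) p (fun x => (cmod (f x))%:E).

Definition Lpnorm (R : realType) (N : nat) (p : \bar R) (f : pt R N -> R)
  : \bar R := Lnorm (lebN R N) p (fun x => (`|f x|)%:E).

Definition inLp (R : realType) (N : nat) (p : \bar R) (f : pt R N -> R) : Prop :=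
  measurable_fun setT f /\ (Lpnorm p f < +oo)%E.

Definition orlicz_int (R : realType) (N : nat) (alpha : R) (absu : pt R N -> R)
  : \bar R :=
  (\int[lebN R N]_x (expR (absu x ^+ 2 / alpha ^+ 2) - 1)%:E)%E.

(* u in exp L^2 : u measurable (L^1_loc is implied) and the Orlicz integral
   is finite for some alpha > 0 *)
Definition in_expL2 (R : realType) (N : nat) (u : pt R N -> R) : Prop :=
  measurable_fun setT u /\
  exists alpha : R, 0 < alpha /\ (orlicz_int alpha (fun x => `|u x|%R) < +oo)%E.

(* Luxemburg norm inf {alpha > 0 : \int (e^{|u|^2/alpha^2} - 1) <= 1}
   (= +oo if the set is empty) *)
Definition expL2_norm_abs (R : realType) (N : nat) (absu : pt R N -> R) : \bar R :=
  ereal_inf [set (alpha%:E)%E | alpha in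
               [set alpha : R | 0 < alpha /\ (orlicz_int alpha absu <= 1)%E]].

Definition expL2_normC (R : realType) (N : nat) (u : pt R N -> R[i]) : \bar R :=
  expL2_norm_abs (fun x => cmod (u x)).
Definition expL2_norm (R : realType) (N : nat) (u : pt R N -> R) : \bar R :=
  expL2_norm_abs (fun x => `|u x|).

(* 1/q for q in [1, +oo] (1/+oo = 0) *)
Definition einv (R : realType) (q : \bar R) : R :=
  match q with r%:E => r^-1 | _ => 0 end.

(* Main.v *)
(* Since e^s - 1 = \sum_(k >= 1) s^k / k!, the Orlicz integral
   \int (e^(|u|^2/a^2) - 1) equals \sum_(k >= 1) ||u||_(2k)^(2k) / (k! a^(2k)),
   so exp L^2 bounds follow from bounds on every even moment of u.
   (i) The L^(2k) -> L^(2k) estimate multiplies the 2k-th moment by at most H^(2k),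
   so the Orlicz integral of e^(-t Delta^2) phi at level H a is at most that of phi
   at level a.
   (ii) The L^p -> L^(2k) estimate gives ||e^(-t Delta^2) phi||_(2k)^(2k)
   <= t^(N/4) D^(2k) with D = H t^(-N/(4p)) ||phi||_p; summing, the Orlicz integral
   at level a is at most t^(N/4) (e^(D^2/a^2) - 1), which is <= 1 as soon as
   a^2 >= D^2 / log (1 + t^(-N/4)).
   (iii) Interpolating the L^q -> L^oo bound with the L^2 bound gives 2k-th moments
   <= B^(2k) with B = H (t^(-N/(4q)) ||phi||_q + ||phi||_2), and e^(B^2/a^2) - 1 <= 1
   as soon as a^2 >= B^2 / log 2. *)

Require Import Defs.
From HB Require Import structures.
From mathcomp Require Import all_boot all_order all_algebra.
From mathcomp Require Import all_classical all_reals all_analysis.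
From mathcomp Require Import complex.
From mathcomp Require Import measurable_realfun ess_sup_inf.
From mathcomp Require Import ring.
Set Implicit Arguments.
Unset Strict Implicit.
Unset Printing Implicit Defensive.
Import Order.TTheory GRing.Theory Num.Theory.
Local Open Scope classical_set_scope.
Local Open Scope ring_scope.

Lemma expR_sub1_nneseries (R : realType) (y : R) : 0 <= y ->
  (\sum_(k <oo) (y ^+ k.+1 / k.+1`!%:R)%:E = (expR y - 1)%:E)%E.
Proof.
move=> y0; have c0 k : (0 <= (exp_coeff y k)%:E)%E.
  by rewrite lee_fin /exp_coeff /= divr_ge0 // exprn_ge0.
have exp_series : (\sum_(k <oo) (exp_coeff y k)%:E = (expR y)%:E)%E.
  rewrite /expR -EFin_lim; last exact: is_cvg_series_exp_coeff.
  by apply: (congr1 (fun u => limn u)); apply/funext => n /=; rewrite sumEFin.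
rewrite EFinB; move: exp_series; rewrite nneseries_recl // -(nneseries_addn 1) // => <-.
rewrite /exp_coeff /= expr0 fact0 divr1 addeAC subee // add0e.
by apply: eq_eseriesr => k _; rewrite addn1.
Qed.

Section orlicz_integral.
Context d (T : measurableType d) (R : realType) (mu : {measure set T -> \bar R}).
Import HBNNSimple.
Local Open Scope ereal_scope.

Lemma ge0_le_integral_nonmeas (f g : T -> \bar R) :
  (forall x, 0 <= f x) -> (forall x, f x <= g x) ->
  \int[mu]_x f x <= \int[mu]_x g x.
Proof.
move=> f0 fg; have g0 x : 0 <= g x by apply: le_trans (f0 x) (fg x).
rewrite !ge0_integralTE //; apply: ereal_sup_le => _ [h /= hf <-].
by exists h => //= x; apply: le_trans (hf x) (fg x).
Qed.

Lemma integral_expR_sqr_sub1 (g : T -> R) (b : R) :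
  (0 < b)%R -> measurable_fun setT g ->
  \int[mu]_x (expR (g x ^+ 2 / b ^+ 2) - 1)%:E =
  \sum_(k <oo) ((k.+1`!%:R * b ^+ (2 * k.+1))^-1)%:E
                 * \int[mu]_x (g x ^+ (2 * k.+1))%:E.
Proof.
move=> b0 mg; have y0 x : (0 <= g x ^+ 2 / b ^+ 2)%R by rewrite divr_ge0 ?sqr_ge0.
under eq_integral do rewrite -expR_sub1_nneseries //.
rewrite integral_nneseries //; last 2 first.
- move=> n; apply/measurable_EFinP; apply: measurable_funM => //.
  by apply: measurable_funX; apply: measurable_funM => //; exact: measurable_funX.
- by move=> n x _; rewrite lee_fin divr_ge0 // exprn_ge0.
apply: eq_eseriesr => k _; rewrite -ge0_integralZl_EFin //; last 3 first.
- by move=> x _; rewrite lee_fin exprM exprn_ge0 // sqr_ge0.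
- by apply/measurable_EFinP; exact: measurable_funX.
- by rewrite invr_ge0 mulr_ge0 // exprn_ge0 // ltW.
apply: eq_integral => x _; congr EFin.
by rewrite expr_div_n -!exprM invfM; ring.
Qed.

Lemma expR_sqr_sub1_minorant (u h : T -> R) (b : R) : (0 < b)%R ->
  measurable_fun setT h -> (forall x, 0 <= u x)%R ->
  (forall x, 0 <= h x <= expR (u x ^+ 2 / b ^+ 2) - 1)%R ->
  exists2 g : T -> R, measurable_fun setT g /\ (forall x, 0 <= g x <= u x)%R
    & forall x, (expR (g x ^+ 2 / b ^+ 2) - 1 = h x)%R.
Proof.
move=> b0 mh u0 hu; pose g x := (b * Num.sqrt (ln (1 + h x)))%R.
have g0 x : (0 <= g x)%R by rewrite mulr_ge0 ?sqrtr_ge0 ?ltW.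
have gE x : (expR (g x ^+ 2 / b ^+ 2) = 1 + h x)%R.
  have /andP[hx0 _] := hu x.
  rewrite exprMn sqr_sqrtr; last by rewrite ln_ge0 // lerDl.
  rewrite mulrAC divff ?mul1r; last by rewrite sqrf_eq0 gt_eqF.
  by rewrite lnK // posrE ltr_pwDl.
exists g; last by move=> x; rewrite gE addrAC subrr add0r.
split.
  apply: measurable_funM => //; apply: measurableT_comp.
    exact: continuous_measurable_fun (@sqrt_continuous R).
  by apply: measurableT_comp; [exact: measurable_ln | exact: measurable_funD].
move=> x; rewrite g0 /=; have /andP[_ hxu] := hu x.
rewrite -(ler_pXn2r (isT : (0 < 2)%N)) ?nnegrE //.
rewrite -(ler_pM2r (_ : 0 < (b ^+ 2)^-1)%R) ?invr_gt0 ?exprn_gt0 //.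
by rewrite -ler_expR gE -lerBrDl.
Qed.

(* [u] need not be measurable: the integral of a nonnegative function is a
   supremum over simple minorants, and each of these is [expR (g ^+ 2 / b ^+ 2) - 1]
   for a measurable [0 <= g <= u], to which the series expansion applies. *)
Lemma integral_expR_sqr_sub1_le (u : T -> R) (b : R) (M : nat -> \bar R) :
  (0 < b)%R -> (forall x, 0 <= u x)%R ->
  (forall g : T -> R, measurable_fun setT g -> (forall x, 0 <= g x <= u x)%R ->
     forall k, \int[mu]_x (g x ^+ (2 * k.+1))%:E <= M k) ->
  \int[mu]_x (expR (u x ^+ 2 / b ^+ 2) - 1)%:E <=
  \sum_(k <oo) ((k.+1`!%:R * b ^+ (2 * k.+1))^-1)%:E * M k.
Proof.
move=> b0 u0 moments; rewrite ge0_integralTE; last first.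
  by move=> x; rewrite lee_fin subr_ge0 -expR0 ler_expR divr_ge0 ?sqr_ge0.
apply: ge_ereal_sup => _ [h /= hu <-].
have [||g [mg gu] gE] := @expR_sqr_sub1_minorant u h b b0 _ u0.
- exact: measurable_funPT.
- by move=> x; rewrite fun_ge0 -lee_fin hu.
have -> : sintegral mu h = \int[mu]_x (h x)%:E.
  by rewrite integral_nnsfun // patch_setT.
under eq_integral do rewrite -gE.
rewrite integral_expR_sqr_sub1 //; apply: lee_nneseries => [k _ _|k _].
  apply: mule_ge0; first by rewrite lee_fin invr_ge0 mulr_ge0 ?exprn_ge0 ?ltW.
  by apply: integral_ge0 => x _; rewrite lee_fin exprM exprn_ge0 ?sqr_ge0.
apply: lee_wpmul2l; last exact: moments.
by rewrite lee_fin invr_ge0 mulr_ge0 ?exprn_ge0 ?ltW.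
Qed.

Lemma integral_expR_sqr_sub1_le_geometric (u : T -> R) (b c B : R) :
  (0 < b)%R -> (0 <= c)%R -> (forall x, 0 <= u x)%R ->
  (forall g : T -> R, measurable_fun setT g -> (forall x, 0 <= g x <= u x)%R ->
     forall k, \int[mu]_x (g x ^+ (2 * k.+1))%:E <= (c * B ^+ (2 * k.+1))%:E) ->
  \int[mu]_x (expR (u x ^+ 2 / b ^+ 2) - 1)%:E <=
  (c * (expR (B ^+ 2 / b ^+ 2) - 1))%:E.
Proof.
move=> b0 c0 u0 moments.
rewrite EFinM -expR_sub1_nneseries ?divr_ge0 ?sqr_ge0 // -nneseriesZl; last first.
  by move=> k _; rewrite lee_fin divr_ge0 // exprn_ge0 // divr_ge0 ?sqr_ge0.
have -> : \sum_(k <oo) (c%:E * ((B ^+ 2 / b ^+ 2) ^+ k.+1 / k.+1`!%:R)%:E) =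
    \sum_(k <oo) ((k.+1`!%:R * b ^+ (2 * k.+1))^-1)%:E * (c * B ^+ (2 * k.+1))%:E.
  apply: eq_eseriesr => k _; rewrite -!EFinM expr_div_n -!exprM invfM.
  by congr EFin; ring.
exact: integral_expR_sqr_sub1_le.
Qed.

Lemma poweR_Lnorm_nat (f : T -> R) (m : nat) :
  (0 < m)%N -> (forall x, 0 <= f x)%R ->
  Lnorm mu m%:R%:E (fun x => (f x)%:E) `^ m%:R = \int[mu]_x (f x ^+ m)%:E.
Proof.
move=> m0 f0; rewrite poweR_Lnorm ?pnatr_eq0 -?lt0n //.
by apply: eq_integral => x _; rewrite abse_EFin poweR_EFin ger0_norm // powR_mulrn.
Qed.

Lemma integral_exprn_le (f : T -> R) (m : nat) (B : R) :
  (0 < m)%N -> (forall x, 0 <= f x)%R -> (0 <= B)%R ->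
  Lnorm mu m%:R%:E (fun x => (f x)%:E) <= B%:E ->
  \int[mu]_x (f x ^+ m)%:E <= (B ^+ m)%:E.
Proof.
move=> m0 f0 B0 fB; rewrite -poweR_Lnorm_nat // -(powR_mulrn _ B0) -poweR_EFin.
by apply: gt0_ler_poweR; rewrite // in_itv /= ?Lnorm_ge0 ?lee_fin ?B0 ?leey.
Qed.

Lemma integral_exprn_le_scale (f g : T -> R) (m : nat) (c : R) :
  (0 < m)%N -> (forall x, 0 <= f x)%R -> (forall x, 0 <= g x)%R -> (0 < c)%R ->
  Lnorm mu m%:R%:E (fun x => (f x)%:E) <=
    c%:E * Lnorm mu m%:R%:E (fun x => (g x)%:E) ->
  \int[mu]_x (f x ^+ m)%:E <= (c ^+ m)%:E * \int[mu]_x (g x ^+ m)%:E.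
Proof.
move=> m0 f0 g0 c0; rewrite -(poweR_Lnorm_nat m0 g0).
have := Lnorm_ge0 mu m%:R%:E (fun x => (g x)%:E).
case: (Lnorm _ _ _) => [r r0 fr | _ _ | //].
  rewrite poweR_EFin powR_mulrn // -EFinM -exprMn.
  apply: integral_exprn_le; rewrite ?EFinM //.
  by apply: mulr_ge0; [exact: ltW | rewrite -lee_fin].
have m_neq0 : (m%:R != 0 :> R)%R by rewrite pnatr_eq0 -lt0n.
by rewrite poweRyr // gt0_muley ?leey // lte_fin exprn_gt0.
Qed.

Lemma ae_le_Lnorm_infty (f : T -> R) (c : R) :
  Lnorm mu +oo (fun x => (f x)%:E) <= c%:E ->
  \forall x \ae mu, (`|f x| <= c)%R.
Proof.
rewrite unlock /=; case: ifPn => [_ /ess_supP | mu0 _].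
  by apply: filterS => x /=; rewrite lee_fin.
exists setT; split => //; apply/eqP; rewrite eq_le measure_ge0 andbT.
by rewrite leNgt.
Qed.

Lemma integral_exprn_le_ae (g : T -> R) (a : R) (n : nat) :
  measurable_fun setT g -> (forall x, 0 <= g x)%R -> (0 <= a)%R ->
  (\forall x \ae mu, (g x <= a)%R) ->
  \int[mu]_x (g x ^+ (n + 2))%:E <= (a ^+ n)%:E * \int[mu]_x (g x ^+ 2)%:E.
Proof.
move=> mg g0 a0 ga.
have mgX k : measurable_fun setT (fun x => (g x ^+ k)%:E).
  by apply/measurable_EFinP; exact: measurable_funX.
rewrite -ge0_integralZl_EFin ?exprn_ge0 //; last by move=> x _; rewrite lee_fin exprn_ge0.
apply: ae_ge0_le_integral => //.
- by move=> x _; rewrite lee_fin exprn_ge0.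
- by move=> x _; rewrite lee_fin mulr_ge0 ?exprn_ge0.
- by apply: emeasurable_funM => //; exact: measurable_cst.
apply: filterS ga => x gxa _; rewrite -EFinM lee_fin exprD.
by rewrite ler_wpM2r ?exprn_ge0 // lerXn2r ?nnegrE.
Qed.

Lemma integral_exprn_le_Linfty_L2 (g u : T -> R) (a b B : R) (n : nat) :
  measurable_fun setT g -> (forall x, 0 <= g x <= u x)%R ->
  (\forall x \ae mu, (u x <= a)%R) -> \int[mu]_x (u x ^+ 2)%:E <= (b ^+ 2)%:E ->
  (0 <= a <= B)%R -> (0 <= b <= B)%R ->
  \int[mu]_x (g x ^+ (n + 2))%:E <= (B ^+ (n + 2))%:E.
Proof.
move=> mg gu ua u2b /andP[a0 aB] /andP[b0 bB].
have g0 x : (0 <= g x)%R by case/andP: (gu x).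
have ga : \forall x \ae mu, (g x <= a)%R.
  by apply: filterS ua => x; case/andP: (gu x) => _ /le_trans; apply.
apply: le_trans (integral_exprn_le_ae n mg g0 a0 ga) _.
apply: le_trans (lee_wpmul2l _ (le_trans _ u2b)) _.
- by rewrite lee_fin exprn_ge0.
- apply: ge0_le_integral_nonmeas => x; first by rewrite lee_fin exprn_ge0.
  by case/andP: (gu x) => gx0 gxu; rewrite lee_fin; apply: lerXn2r; rewrite ?nnegrE ?(le_trans gx0).
have B0 := le_trans a0 aB; rewrite -EFinM lee_fin exprD.
by apply: ler_pM; rewrite ?exprn_ge0 //; apply: lerXn2r; rewrite ?nnegrE.
Qed.
End orlicz_integral.

Lemma powR_subinv_exprn (R : realType) (t s r : R) (m : nat) :
  0 < t -> (0 < m)%N ->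
  powR t (- s * (r - m%:R^-1)) ^+ m = powR t s * powR t (- (s * r)) ^+ m.
Proof.
move=> t0 m0; have mR0 : m%:R != 0 :> R by rewrite pnatr_eq0 -lt0n.
rewrite -!powR_mulrn ?powR_ge0 // -!powRrM -powRD; last by rewrite lt0r_neq0 ?implybT.
by rewrite (_ : - s * (r - m%:R^-1) * m%:R = s + - (s * r) * m%:R) //; field.
Qed.

Lemma cmod_ge0 (R : realType) (z : R[i]) : 0 <= cmod z.
Proof. exact: sqrtr_ge0. Qed.

Lemma expL2_norm_abs_le (R : realType) (N : nat) (u : pt R N -> R) (b0 : R) :
  0 <= b0 -> (forall b, b0 < b -> (orlicz_int b u <= 1)%E) ->
  (expL2_norm_abs u <= b0%:E)%E.
Proof.
move=> b00 orlicz_le1; apply/lee_addgt0Pr => e e0.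
apply: ereal_inf_lbound; exists (b0 + e) => //; split; first by rewrite ltr_wpDl.
by apply: orlicz_le1; rewrite ltrDl.
Qed.

Lemma expL2_norm_abs_le_moments (R : realType) (N : nat) (u : pt R N -> R)
    (c B : R) : 0 < c -> 0 <= B -> (forall x, 0 <= u x) ->
  (forall g : pt R N -> R, measurable_fun setT g -> (forall x, 0 <= g x <= u x) ->
     forall k, (\int[lebN R N]_x (g x ^+ (2 * k.+1))%:E
                  <= (c * B ^+ (2 * k.+1))%:E)%E) ->
  (expL2_norm_abs u <= (B / Num.sqrt (ln (1 + c^-1)))%:E)%E.
Proof.
move=> c0 B0 u0 moments; set l := ln (1 + c^-1).
have l0 : 0 < l by rewrite ln_gt0 // ltrDl invr_gt0.
have sl0 : 0 < Num.sqrt l by rewrite sqrtr_gt0.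
apply: expL2_norm_abs_le; first by rewrite divr_ge0 // ltW.
move=> b Bb; have b0 : 0 < b by apply: le_lt_trans Bb; rewrite divr_ge0 // ltW.
have Bbl : B ^+ 2 / b ^+ 2 <= l.
  have Bb' : B <= b * Num.sqrt l by rewrite -ler_pdivrMr // ltW.
  rewrite ler_pdivrMr ?exprn_gt0 // -[l](sqr_sqrtr (ltW l0)) -exprMn mulrC.
  by rewrite lerXn2r // nnegrE mulr_ge0 ?sqrtr_ge0 // ltW.
apply: le_trans (integral_expR_sqr_sub1_le_geometric b0 (ltW c0) u0 moments) _.
rewrite lee_fin -[leRHS](divff (lt0r_neq0 c0)) ler_pM2l // lerBlDl.
by rewrite -[X in _ <= X]lnK ?ler_expR // posrE addr_gt0 ?invr_gt0.
Qed.

Section biharmonic_semigroup_on_expL2.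
Variables (R : realType) (N : nat) (H : R).
Hypothesis H_gt0 : 0 < H.
Hypothesis Lp_Lq_estimate : forall (p q : \bar R) (t : R) (phi : pt R N -> R),
  (1 <= p)%E -> (p <= q)%E -> 0 < t -> inLp p phi ->
  (LpnormC q (biharm_sg t phi)
    <= (H * powR t (- (N%:R / 4) * (einv p - einv q)))%:E * Lpnorm p phi)%E.

Lemma LpnormC_biharm_sg_le (p : \bar R) (t : R) (phi : pt R N -> R) :
  (1 <= p)%E -> 0 < t -> measurable_fun setT phi ->
  (LpnormC p (biharm_sg t phi) <= H%:E * Lpnorm p phi)%E.
Proof.
move=> p1 t0 mphi; have [phi_fin|] := ltP (Lpnorm p phi) +oo%E.
  have := Lp_Lq_estimate p1 (lexx p) t0 (conj mphi phi_fin).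
  by rewrite subrr mulr0 powRr0 mulr1.
by rewrite leye_eq => /eqP ->; rewrite gt0_muley ?lte_fin // leey.
Qed.

Lemma expL2_normC_biharm_sg_le (t : R) (phi : pt R N -> R) :
  0 < t -> in_expL2 phi ->
  (expL2_normC (biharm_sg t phi) <= H%:E * expL2_norm phi)%E.
Proof.
move=> t0 [mphi _]; rewrite /expL2_normC /expL2_norm /expL2_norm_abs.
rewrite -ereal_inf_pZl //; apply: ereal_inf_le_tmp => _ [_ [a [a0 phi_a] <-] <-].
exists (H * a); last by rewrite EFinM.
split; first exact: mulr_gt0.
have mabsphi : measurable_fun setT (fun x => `|phi x|) by exact: measurableT_comp.
apply: le_trans phi_a; rewrite /orlicz_int (integral_expR_sqr_sub1 _ a0 mabsphi).
apply: le_trans (integral_expR_sqr_sub1_le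
  (M := fun k => (H ^+ (2 * k.+1))%:E
                   * \int[lebN R N]_x (`|phi x| ^+ (2 * k.+1))%:E)%E _ _ _) _.
- exact: mulr_gt0.
- by move=> x; exact: cmod_ge0.
- move=> g mg gu k; set m := (2 * k.+1)%N.
  apply: le_trans (integral_exprn_le_scale (f := fun x => cmod (biharm_sg t phi x))
    (g := fun x => `|phi x|) _ _ _ H_gt0 _).
  + apply: ge0_le_integral_nonmeas => x; case/andP: (gu x) => gx0 gxu.
      by rewrite lee_fin exprn_ge0.
    by rewrite lee_fin lerXn2r // nnegrE (le_trans gx0).
  + by rewrite muln_gt0.
  + by move=> x; exact: cmod_ge0.
  + by move=> x; exact: normr_ge0.
  + by apply: LpnormC_biharm_sg_le; rewrite // lee_fin ler1n muln_gt0.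
apply: lee_nneseries => [k _ _|k _].
  have Ha0 : 0 <= H * a by rewrite mulr_ge0 ?ltW.
  apply: mule_ge0; first by rewrite lee_fin invr_ge0 mulr_ge0 ?exprn_ge0.
  apply: mule_ge0; first by rewrite lee_fin exprn_ge0 ?ltW.
  by apply: integral_ge0 => x _; rewrite lee_fin exprn_ge0.
have fact_neq0 : k.+1`!%:R != 0 :> R by rewrite pnatr_eq0 -lt0n fact_gt0.
rewrite muleA -EFinM exprMn; set m := (2 * k.+1)%N.
suff -> : (k.+1`!%:R * (H ^+ m * a ^+ m))^-1 * H ^+ m = (k.+1`!%:R * a ^+ m)^-1 by [].
by field; rewrite fact_neq0 !expf_neq0 ?lt0r_neq0.
Qed.

Lemma expL2_normC_biharm_sg_le_Lp (p t : R) (phi : pt R N -> R) :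
  1 <= p <= 2 -> 0 < t -> inLp p%:E phi ->
  (expL2_normC (biharm_sg t phi)
    <= (H * powR t (- (N%:R / (4 * p)))
          * powR (ln (powR t (- (N%:R / 4)) + 1)) (- 2^-1))%:E
       * Lpnorm p%:E phi)%E.
Proof.
move=> /andP[p1 p2] t0 [mphi phi_fin]; have p0 : 0 < p by apply: lt_le_trans p1.
set A := fine (Lpnorm p%:E phi).
have EA : Lpnorm p%:E phi = A%:E by rewrite fineK // ge0_fin_numE ?Lnorm_ge0.
have A0 : 0 <= A by rewrite -lee_fin -EA Lnorm_ge0.
set c := powR t (N%:R / 4); have c0 : 0 < c by rewrite powR_gt0.
set B := H * A * powR t (- (N%:R / (4 * p))).
have -> : ((H * powR t (- (N%:R / (4 * p)))
           * powR (ln (powR t (- (N%:R / 4)) + 1)) (- 2^-1))%:E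
          * Lpnorm p%:E phi = (B / Num.sqrt (ln (1 + c^-1)))%:E)%E.
  have -> : 1 + c^-1 = powR t (- (N%:R / 4)) + 1 by rewrite /c -powRN addrC.
  set L := ln _; have L0 : 0 <= L by rewrite ln_ge0 // lerDr powR_ge0.
  rewrite EA -EFinM /B [powR L _]powRN powR12_sqrt //.
  by congr EFin; ring.
apply: expL2_norm_abs_le_moments => //.
- by rewrite /B mulr_ge0 ?powR_ge0 // mulr_ge0 // ltW.
- by move=> x; exact: cmod_ge0.
move=> g mg gu k; set m := (2 * k.+1)%N.
have m0 : (0 < m)%N by rewrite muln_gt0.
apply: le_trans (ge0_le_integral_nonmeas (lebN R N) (f := fun x => (g x ^+ m)%:E)
  (g := fun x => (cmod (biharm_sg t phi x) ^+ m)%:E) _ _) _.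
- by move=> x; rewrite lee_fin exprn_ge0 //; case/andP: (gu x).
- by move=> x; case/andP: (gu x) => gx0 gxu; rewrite lee_fin lerXn2r // nnegrE (le_trans gx0).
have -> : c * B ^+ m = (H * powR t (- (N%:R / 4) * (p^-1 - m%:R^-1)) * A) ^+ m.
  rewrite /c /B (_ : N%:R / (4 * p) = N%:R / 4 * p^-1); last by rewrite invfM mulrA.
  by rewrite !exprMn (powR_subinv_exprn (N%:R / 4) p^-1 t0 m0); ring.
have pm : (p%:E <= m%:R%:E)%E by rewrite lee_fin (le_trans p2) // ler_nat leq_pmulr.
have := Lp_Lq_estimate (lee_tofin p1) pm t0 (conj mphi phi_fin).
rewrite EA -EFinM => estimate.
apply: integral_exprn_le; first exact: m0.
- by move=> x; exact: cmod_ge0.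
- by rewrite mulr_ge0 // mulr_ge0 ?powR_ge0 ?ltW.
exact: estimate.
Qed.

Lemma expL2_normC_biharm_sg_le_LqL2 (q : \bar R) (t : R) (phi : pt R N -> R) :
  (1 <= q)%E -> 0 < t -> inLp q phi -> inLp 2%:E phi ->
  (expL2_normC (biharm_sg t phi)
    <= (H / Num.sqrt (ln 2))%:E
       * ((powR t (- (N%:R / 4 * einv q)))%:E * Lpnorm q phi
          + Lpnorm 2%:E phi))%E.
Proof.
move=> q1 t0 [mphi phi_finq] [_ phi_fin2].
set Aq := fine (Lpnorm q phi).
have EAq : Lpnorm q phi = Aq%:E by rewrite fineK // ge0_fin_numE ?Lnorm_ge0.
have Aq0 : 0 <= Aq by rewrite -lee_fin -EAq Lnorm_ge0.
set A2 := fine (Lpnorm 2%:E phi).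
have EA2 : Lpnorm 2%:E phi = A2%:E by rewrite fineK // ge0_fin_numE ?Lnorm_ge0.
have A20 : 0 <= A2 by rewrite -lee_fin -EA2 Lnorm_ge0.
set a := powR t (- (N%:R / 4 * einv q)) * Aq.
have a0 : 0 <= a by rewrite mulr_ge0 ?powR_ge0.
set B := H * (a + A2).
have Ha0 : 0 <= H * a by rewrite mulr_ge0 // ltW.
have HA20 : 0 <= H * A2 by rewrite mulr_ge0 // ltW.
have HaB : H * a <= B by rewrite /B ler_pM2l // lerDl.
have HA2B : H * A2 <= B by rewrite /B ler_pM2l // lerDr.
have -> : ((H / Num.sqrt (ln 2))%:E * ((powR t (- (N%:R / 4 * einv q)))%:E
          * Lpnorm q phi + Lpnorm 2%:E phi) = (B / Num.sqrt (ln (1 + 1^-1)))%:E)%E.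
  by rewrite EAq EA2 invr1 -mulr2n -EFinM /B /a; congr EFin; ring.
set u := fun x => cmod (biharm_sg t phi x).
have u0 x : 0 <= u x by exact: cmod_ge0.
have u_ess_bounded : \forall x \ae lebN R N, u x <= H * a.
  have := Lp_Lq_estimate q1 (leey q) t0 (conj mphi phi_finq).
  rewrite subr0 mulNr EAq -EFinM -mulrA => /ae_le_Lnorm_infty.
  by apply: filterS => x; rewrite ger0_norm ?cmod_ge0.
have u_L2 : (\int[lebN R N]_x (u x ^+ 2)%:E <= ((H * A2) ^+ 2)%:E)%E.
  apply: integral_exprn_le => //.
  by rewrite EFinM -EA2; apply: LpnormC_biharm_sg_le; rewrite ?lee_fin ?ler1n.
apply: expL2_norm_abs_le_moments => //; first exact: le_trans Ha0 HaB.
move=> g mg gu k; rewrite mul1r mulnS addnC.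
by apply: (integral_exprn_le_Linfty_L2 _ mg gu u_ess_bounded u_L2); rewrite ?Ha0 ?HA20.
Qed.

End biharmonic_semigroup_on_expL2.

Theorem proposition3p4 (R : realType) (N : nat) (H : R) :
  (0 < N)%N -> 0 < H ->
  (forall (p q : \bar R) (t : R) (phi : pt R N -> R),
      (1 <= p)%E -> (p <= q)%E -> 0 < t -> inLp p phi ->
      (LpnormC q (biharm_sg t phi)
        <= (H * powR t (- (N%:R / 4) * (einv p - einv q)))%:E * Lpnorm p phi)%E) ->
  forall (p : R) (q : \bar R), 1 <= p <= 2 -> (1 <= q)%E ->
  [/\ (* (i) *)
      (forall (t : R) (phi : pt R N -> R), 0 < t -> in_expL2 phi ->
         (expL2_normC (biharm_sg t phi) <= H%:E * expL2_norm phi)%E),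
      (* (ii) *)
      (forall (t : R) (phi : pt R N -> R), 0 < t -> inLp p%:E phi ->
         (expL2_normC (biharm_sg t phi)
           <= (H * powR t (- (N%:R / (4 * p)))
                 * powR (ln (powR t (- (N%:R / 4)) + 1)) (- 2^-1))%:E
              * Lpnorm p%:E phi)%E)
    & (* (iii) *)
      (forall (t : R) (phi : pt R N -> R), 0 < t -> inLp q phi -> inLp 2%:E phi ->
         (expL2_normC (biharm_sg t phi)
           <= (H / Num.sqrt (ln 2))%:E
              * ((powR t (- (N%:R / 4 * einv q)))%:E * Lpnorm q phi
                 + Lpnorm 2%:E phi))%E)].
Proof.
move=> _ H0 estimate p q p12 q1; split.
- by move=> t phi; apply: expL2_normC_biharm_sg_le.
- by move=> t phi; apply: expL2_normC_biharm_sg_le_Lp.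
- by move=> t phi; apply: expL2_normC_biharm_sg_le_LqL2.
Qed.
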